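(* Let $n\ge1$ and let $h_m^{(n)}(q)$, $0\le m\le n-1$, be defined by the recursive equations given in the context. If $0\le m\le n-1$, then $$\begin{aligned}h_m^{(n)}(q)&=\sum_{k=0}^{[m/2]}(-q^{2n-2};q^{-2})_{m-2k}\begin{bmatrix}n-m+2k\\k\end{bmatrix}_{q^4}\frac{1-q^{4(n-m)}}{1-q^{4(n-m+2k)}}\,q^{4k}\\&=\sum_{k=0}^{[m/2]}(-q^{2n-2};q^{-2})_{m-2k}\left(\begin{bmatrix}n-m+2k-1\\k\end{bmatrix}_{q^4}-\begin{bmatrix}n-m+2k-1\\k-1\end{bmatrix}_{q^4}\right),\end{aligned}$$ where $\begin{bmatrix}n-m-1\\-1\end{bmatrix}_{q^4}=0$.
   Context: For non-negative integers $n,k$: $(A;q)_n=\prod_{k=0}^{n-1}(1-Aq^k)$ and $\begin{bmatrix}n\\k\end{bmatrix}_q=\dfrac{(q^n;q^{-1})_k}{(q;q)_k}$. $[a]$ denotes the integer part of $a$. For $0\le k\le n-1$ let $$og_{k,2n}(q)=\frac{(q^{4(n-k)};q^4)_k}{(q^2;q^2)_k}\cdot\frac{1-q^{2n}}{1-q^{2(n-k)}}.$$ For $n\ge1$, the functions $h_j^{(n)}(q)$, $0\le j\le n-1$, are defined recursively by the $n$ equations $$og_{k,2n}(q)=\sum_{j=0}^kq^{(k-j)(k-j+1)}\,h_j^{(n)}(q)\begin{bmatrix}2n-1-k-j\\k-j\end{bmatrix}_{q^2},\qquad 0\le k\le n-1.$$ *)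

(* Defs.v *)
From mathcomp Require Import all_boot all_order all_algebra.

Set Implicit Arguments.
Unset Strict Implicit.
Unset Printing Implicit Defensive.

Import GRing.Theory.
Local Open Scope ring_scope.

(* All functions of q are evaluated at a point q of an arbitrary field; q as a
   formal variable is the case F = {fraction {poly K}}. *)

(* (A; q)_n *)
Definition qpoch (F : fieldType) (A q : F) (n : nat) : F :=
  \prod_(i < n) (1 - A * q ^+ i).

(* The lower index is an integer because the convention that the coefficient
   vanishes at lower index -1 is used. *)
Definition qbinom (F : fieldType) (q : F) (n : nat) (k : int) : F :=
  match k with
  | Posz k' => qpoch (q ^+ n) q^-1 k' / qpoch q q k'
  | Negz _ => 0
  end.

(* og_{k,2n}(q), for k < n *)
Definition og (F : fieldType) (q : F) (n k : nat) : F :=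
  qpoch (q ^+ (4 * (n - k))) (q ^+ 4) k / qpoch (q ^+ 2) (q ^+ 2) k
  * ((1 - q ^+ (2 * n)) / (1 - q ^+ (2 * (n - k)))).

(* h 0, ..., h (n - 1) are the values at q of h_0^(n), ..., h_(n-1)^(n).  The
   system is unitriangular (the coefficient of h k in equation k is 1), so it
   determines these values; the values h j for j >= n are irrelevant. *)
Definition h_equations (F : fieldType) (q : F) (n : nat) (h : nat -> F) : Prop :=
  forall k : nat, (k < n)%N ->
    og q n k =
    \sum_(0 <= j < k.+1)
      q ^+ ((k - j) * (k - j + 1)) * h j
      * qbinom (q ^+ 2) (2 * n - 1 - k - j) (k - j)%N.

(* Main.v *)
Require Import Defs.
From mathcomp Require Import all_boot all_order all_algebra.
From mathcomp Require Import zify ring.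

Set Implicit Arguments.
Unset Strict Implicit.
Unset Printing Implicit Defensive.

Import GRing.Theory.
Local Open Scope ring_scope.

(** Write p = q ^ 2, M = n - 1 and P(r) = (- p ^ M; p ^ -1)_r.  The system is
    unitriangular, so it has a single solution ([h_equations_unique]) and it is
    enough to see that the second formula, [h_sum], solves it
    ([h_sum_equations]); the first formula agrees with it term by term
    ([qbinom_diff]).

    With the base p, the left-hand side of equation k is
    [n, k]_p P(k) ([ogE]).  On the right-hand side, insert the formula for h_j
    and put r = j - 2 i.  The bracketed difference of base-p^2 binomials in
    [h_sum] depends on j and i only through i and r, so the double sum becomes
    a sum over r of P(r) times an inner sum over i ([sum_triangle]).  With M
    and k in place of M - r and k - r, the inner sum is

      sum_i p ^ C(k - 2 i + 1, 2) ([M, i] - [M, i - 1])_(p^2)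
            [2 M + 1 - k - 2 i, k - 2 i]_p  =  p ^ k [M, k]_p (- p ^ M; p ^ -1)_k.

    This is a limiting case of the terminating very-well-poised 6phi5
    summation in base p^2; passing from k to k + 1 shifts a single one of its
    parameters, and hence the sum satisfies a first-order recurrence in k with
    an explicit telescoping certificate ([wz_step], [sum_inner]).

    Finally (- p ^ (M - r); p ^ -1)_(k - r) P(r) = P(k), and what remains is
    the q-hockey-stick identity
    sum_r p ^ (k - r) [M - r, k - r]_p = [M + 1, k]_p
    ([qbinom_hockey_stick]). *)

(** * q-Pochhammer symbols and q-binomial coefficients *)

Arguments qbinom : simpl never.

Lemma subr1X_neq0 (F : fieldType) (p : F) (p_nu : forall i : nat, (0 < i)%N -> p ^+ i != 1)
    (k : nat) : (0 < k)%N -> 1 - p ^+ k != 0.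
Proof. by move=> k_gt0; rewrite subr_eq0 eq_sym p_nu. Qed.

Lemma qpochS (F : fieldType) (A p : F) (k : nat) :
  qpoch A p k.+1 = qpoch A p k * (1 - A * p ^+ k).
Proof. by rewrite /qpoch big_ord_recr. Qed.

Lemma qpochSl (F : fieldType) (A p : F) (k : nat) :
  qpoch A p k.+1 = (1 - A) * qpoch (A * p) p k.
Proof.
rewrite /qpoch big_ord_recl mulr1; congr (_ * _); apply: eq_bigr => i _.
by rewrite /= /bump /= exprS mulrA.
Qed.

Lemma qpochpp_neq0 (F : fieldType) (p : F) (p_nu : forall i : nat, (0 < i)%N -> p ^+ i != 1)
    (k : nat) : qpoch p p k != 0.
Proof.
by apply/prodf_neq0 => i _; rewrite -exprS subr1X_neq0.
Qed.

Lemma qbinom_low0 (F : fieldType) (p : F) (n : nat) : qbinom p n 0%:Z = 1.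
Proof. by rewrite /qbinom /qpoch !big_ord0 divr1. Qed.

Lemma qbinomN (F : fieldType) (p : F) (n : nat) (k : int) : k < 0 -> qbinom p n k = 0.
Proof. by case: k. Qed.

Lemma expr_div_subn (F : fieldType) (p : F) (p_neq0 : p != 0) (n k : nat) :
  (k <= n)%N -> p ^+ n * p^-1 ^+ k = p ^+ (n - k).
Proof.
move=> le_kn; rewrite -{1}(subnK le_kn) exprD exprVn mulfK //.
exact: expf_neq0.
Qed.

Lemma qbinom_next_low (F : fieldType) (p : F) (p_neq0 : p != 0)
    (p_nu : forall i : nat, (0 < i)%N -> p ^+ i != 1) (n k : nat) :
  (k <= n)%N ->
  (1 - p ^+ k.+1) * qbinom p n k.+1 = (1 - p ^+ (n - k)) * qbinom p n k.
Proof.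
move=> le_kn; rewrite /qbinom !qpochS expr_div_subn // -exprS.
have D := qpochpp_neq0 p_nu k.
have E := subr1X_neq0 p_nu (ltn0Sn k).
field.
by rewrite D E.
Qed.

Lemma qbinom_absorb (F : fieldType) (p : F) (p_neq0 : p != 0)
    (p_nu : forall i : nat, (0 < i)%N -> p ^+ i != 1) (n k : nat) :
  (1 - p ^+ k.+1) * qbinom p n.+1 k.+1 = (1 - p ^+ n.+1) * qbinom p n k.
Proof.
rewrite /qbinom (qpochSl (p ^+ n.+1)) qpochS -exprS.
rewrite [p ^+ n.+1 * p^-1](@expr_div_subn _ _ p_neq0 n.+1 1) // subn1 /=.
have D := qpochpp_neq0 p_nu k.
have E := subr1X_neq0 p_nu (ltn0Sn k).
field.
by rewrite D E.
Qed.

Lemma qbinom_pascal (F : fieldType) (p : F) (p_neq0 : p != 0)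
    (p_nu : forall i : nat, (0 < i)%N -> p ^+ i != 1) (n k : nat) :
  (k <= n)%N ->
  qbinom p n.+1 k.+1 = qbinom p n k + p ^+ k.+1 * qbinom p n k.+1.
Proof.
move=> le_kn; apply: (mulfI (subr1X_neq0 p_nu (ltn0Sn k))).
rewrite qbinom_absorb // mulrDr [X in _ = _ + X]mulrCA qbinom_next_low //.
have -> : p ^+ n.+1 = p ^+ k.+1 * p ^+ (n - k) by rewrite -exprD; congr (_ ^+ _); lia.
ring.
Qed.

Lemma qbinom_hockey_stick (F : fieldType) (p : F) (p_neq0 : p != 0)
    (p_nu : forall i : nat, (0 < i)%N -> p ^+ i != 1) (k n : nat) :
  (k <= n)%N ->
  \sum_(0 <= r < k.+1) p ^+ (k - r) * qbinom p (n - r) (k - r)%N = qbinom p n.+1 k.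
Proof.
elim: k n => [|k IH] n le_kn; first by rewrite big_nat1 !qbinom_low0 mulr1.
case: n le_kn => [//|n] le_kn.
rewrite big_nat_recl //= !subn0 [RHS]qbinom_pascal; [|done|done|lia].
by rewrite addrC -IH.
Qed.

(** The difference on the right is the ballot-type multiple
    (p ^ k - p ^ (n + k)) / (1 - p ^ (n + 2 k)) of [n + 2 k, k]. *)
Lemma qbinom_diff (F : fieldType) (p : F) (p_neq0 : p != 0)
    (p_nu : forall i : nat, (0 < i)%N -> p ^+ i != 1) (n k : nat) :
  (0 < n)%N ->
  qbinom p (n + 2 * k) k * ((1 - p ^+ n) / (1 - p ^+ (n + 2 * k))) * p ^+ k
  = qbinom p (n + 2 * k - 1) k - qbinom p (n + 2 * k - 1) (k%:Z - 1).
Proof.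
move=> n_gt0; case: k => [|k].
  rewrite muln0 addn0 !qbinom_low0 qbinomN // divff ?subr1X_neq0 //.
  by rewrite subr0 !mulr1.
have -> : (k.+1%:Z - 1)%R = k%:Z by lia.
have -> : (n + 2 * k.+1 = (n + 2 * k).+2)%N by lia.
rewrite subn1 /=.
have H0 := subr1X_neq0 p_nu (ltn0Sn k).
have H1 := subr1X_neq0 p_nu (ltn0Sn (n + 2 * k).+1).
have/(canRL (mulKf H0)) -> := qbinom_absorb p_neq0 p_nu (n + 2 * k).+1 k.
have/(canRL (mulKf H0)) -> := @qbinom_next_low F p p_neq0 p_nu (n + 2 * k).+1 k ltac:(lia).
have -> : ((n + 2 * k).+1 - k = n + k.+1)%N by lia.
rewrite exprD.
field.
by rewrite H0 H1.
Qed.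

(** * The inner sum *)

(** The integer lower index of the last factor makes the summand vanish as soon
    as 2 i > K, where the truncated exponent and upper index are meaningless. *)
Definition inner_summand (F : fieldType) (p : F) (M K i : nat) : F :=
  p ^+ 'C(K + 1 - 2 * i, 2)
  * (qbinom (p ^+ 2) M i - qbinom (p ^+ 2) M (i%:Z - 1))
  * qbinom p (2 * M + 1 - K - 2 * i) (K%:Z - (2 * i)%:Z).

(** It is a rational multiple of the summand; binomials are used instead of the
    quotient so that it stays defined, and vanishes, at i = 0 and for
    2 i > K + 1.  The division by p avoids a truncated subtraction in the exponent. *)
Definition wz_cert (F : fieldType) (p : F) (M K i : nat) : F :=
  - (1 - p ^+ (2 * (M - K))) * (p ^+ ('C(K + 3 - 2 * i, 2) + 2 * i) / p)
  * qbinom (p ^+ 2) M (i%:Z - 1)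
  * qbinom p (2 * M + 2 - K - 2 * i) (K%:Z + 1 - (2 * i)%:Z).

Lemma sqr_not_unity_root (F : fieldType) (p : F) (p_nu : forall i : nat, (0 < i)%N -> p ^+ i != 1) :
  forall i : nat, (0 < i)%N -> (p ^+ 2) ^+ i != 1.
Proof. by move=> i i_gt0; rewrite -exprM p_nu // muln_gt0. Qed.

(** Since [n, -1] = 0, the ratio of consecutive coefficients also holds at
    k = 0, which makes the first term of the telescoping sum regular. *)
Lemma qbinom_prev_low (F : fieldType) (p : F) (p_neq0 : p != 0)
    (p_nu : forall i : nat, (0 < i)%N -> p ^+ i != 1) (n k : nat) :
  (k <= n.+1)%N ->
  (1 - p ^+ k) * qbinom p n k = (1 - p ^+ (n.+1 - k)) * qbinom p n (k%:Z - 1).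
Proof.
case: k => [|k] le_kn; first by rewrite expr0 subrr mul0r qbinomN // mulr0.
have -> : (k.+1%:Z - 1)%R = k%:Z by lia.
by rewrite qbinom_next_low.
Qed.

(** Every base-p binomial in sight is a rational multiple of [n + 1, L]_p, and
    the two base-p^2 binomials a = [M, i] and b = [M, i - 1] are tied by one
    linear relation.  The identity is that relation times a rational factor. *)
Lemma wz_step_nneg (F : fieldType) (p : F) (p_neq0 : p != 0)
    (p_nu : forall i : nat, (0 < i)%N -> p ^+ i != 1) (s L i : nat) :
  let K := (L + 2 * i)%N in let M := (K + s.+1)%N in
  (1 - p ^+ K.+1) * inner_summand p M K.+1 i
  - p * (1 - p ^+ (2 * (M - K))) * inner_summand p M K i
  = wz_cert p M K i.+1 - wz_cert p M K i.
Proof.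
move=> K M; rewrite /inner_summand /wz_cert.
have -> : (i.+1%:Z - 1)%R = i%:Z by lia.
have -> : (K.+1%:Z - (2 * i)%:Z)%R = L.+1%:Z by lia.
have -> : (K%:Z - (2 * i)%:Z)%R = L%:Z by lia.
have -> : (K%:Z + 1 - (2 * i.+1)%:Z)%R = (L%:Z - 1)%R by lia.
have -> : (K%:Z + 1 - (2 * i)%:Z)%R = L.+1%:Z by lia.
have -> : (K.+1 + 1 - 2 * i = L.+2)%N by lia.
have -> : (K + 1 - 2 * i = L.+1)%N by lia.
have -> : (K + 3 - 2 * i.+1 = L.+1)%N by lia.
have -> : (K + 3 - 2 * i = L.+3)%N by lia.
pose n := (2 * s + L + 2)%N.
have -> : (2 * M + 1 - K.+1 - 2 * i = n)%N by lia.
have -> : (2 * M + 1 - K - 2 * i = n.+1)%N by lia.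
have -> : (2 * M + 2 - K - 2 * i.+1 = n)%N by lia.
have -> : (2 * M + 2 - K - 2 * i = n.+2)%N by lia.
have HL := subr1X_neq0 p_nu (ltn0Sn L).
have Hn := subr1X_neq0 p_nu (ltn0Sn n).
(* the base-p binomials in terms of [n + 1, L] *)
have EX := qbinom_absorb p_neq0 p_nu n.+1 L.
have EV := @qbinom_next_low F p p_neq0 p_nu n.+1 L ltac:(lia).
have EZ : (1 - p ^+ L) * qbinom p n.+1 L = (1 - p ^+ n.+1) * qbinom p n (L%:Z - 1).
  case: (L) => [|L']; first by rewrite expr0 subrr mul0r qbinomN // mulr0.
  have -> : (L'.+1%:Z - 1)%R = L'%:Z by lia.
  by rewrite qbinom_absorb.
have EW : (1 - p ^+ (2 * s + 2)) * qbinom p n.+1 L.+1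
          = (1 - p ^+ n.+1) * qbinom p n L.+1.
  have := @qbinom_next_low F p p_neq0 p_nu n L ltac:(lia).
  have := qbinom_absorb p_neq0 p_nu n L.
  have -> : (n - L = 2 * s + 2)%N by lia.
  move=> E1 E2; apply: (mulfI HL).
  by rewrite mulrCA E1 [RHS]mulrCA E2 mulrCA.
have Eab := @qbinom_prev_low F (p ^+ 2) (expf_neq0 _ p_neq0) (sqr_not_unity_root p_nu)
  M i ltac:(lia).
have {EV}EW : (1 - p ^+ n.+1) * qbinom p n L.+1
    = (1 - p ^+ (2 * s + 2)) * ((1 - p ^+ L.+1)^-1 * ((1 - p ^+ (2 * s + 3)) * qbinom p n.+1 L)).
  rewrite -EW; congr (_ * _); apply: (mulfI HL); rewrite EV mulVKf //.
  by congr ((1 - p ^+ _) * _); lia.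
move/(canRL (mulKf HL)): EX => ->.
move/(canRL (mulKf Hn)): EW => ->.
move/esym/(canRL (mulKf Hn)): EZ => ->.
rewrite -!exprM in Eab.
have E2 m : 'C(m.+1, 2) = ('C(m, 2) + m)%N by rewrite binS bin1.
move: (qbinom p n.+1 L) (qbinom (p ^+ 2) M i) (qbinom (p ^+ 2) M (i%:Z - 1)) Eab HL Hn.
rewrite (E2 L.+2) (E2 L.+1).
move: ('C(L.+1, 2)) => c Y a b Eab.
have X1 : p ^+ (2 * (M.+1 - i)) = p ^+ (2 * s + 2) * p ^+ 2 * p ^+ L ^+ 2 * p ^+ (2 * i).
  by rewrite -exprM -!exprD; congr (_ ^+ _); lia.
have X2 : p ^+ K.+1 = p * p ^+ L * p ^+ (2 * i).
  by rewrite -exprS -!exprD; congr (_ ^+ _); lia.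
have X3 : p ^+ (2 * (M - K)) = p ^+ (2 * s + 2) by congr (_ ^+ _); lia.
have X4 : p ^+ n.+1 = p ^+ (2 * s + 2) * p * p ^+ L.
  by rewrite -exprSr -!exprD; congr (_ ^+ _); lia.
have X5 : p ^+ (2 * s + 3) = p ^+ (2 * s + 2) * p.
  by rewrite -exprSr; congr (_ ^+ _); lia.
have X6 : p ^+ (2 * i.+1) = p ^+ 2 * p ^+ (2 * i).
  by rewrite -!exprD; congr (_ ^+ _); lia.
move: Eab; rewrite X1 X2 X3 (exprS p n.+1) X4 X5 (exprS p L).
move: (p ^+ (2 * s + 2)) => e Eab HL Hn.
rewrite (exprD p _ (2 * i)) (exprD p _ (2 * i.+1)) X6 (exprD p _ L.+2) (exprD p _ L.+1).
rewrite (exprS p L.+1) (exprS p L).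
move: (p ^+ c) (p ^+ (2 * i)) (p ^+ L) Eab HL Hn => {}c y x Eab HL Hn.
have {}Eab : (1 - y) * a - (1 - e * p ^+ 2 * x ^+ 2 * y) * b = 0.
  by apply/eqP; rewrite subr_eq0 Eab.
apply/eqP; rewrite -subr_eq0; apply/eqP.
(* x = p ^ L, y = p ^ (2 i), e = p ^ (2 s + 2), c = p ^ C(L + 1, 2): the
   cofactor of the relation is read off from the coefficient of a. *)
transitivity (p * (1 - e) * c * Y / ((1 - p * x) * (1 - e * p * x))
    * (x + p * x - e * p ^+ 2 * x ^+ 2 - 1)
    * ((1 - y) * a - (1 - e * p ^+ 2 * x ^+ 2 * y) * b)).
  by field; rewrite HL Hn p_neq0.
by rewrite Eab mulr0.
Qed.

(** Beyond the generic range 2 i <= K, only 2 i = K + 1 has nonzero terms: the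
    last summand for K + 1 then cancels against the certificate. *)
Lemma wz_step (F : fieldType) (p : F) (p_neq0 : p != 0)
    (p_nu : forall i : nat, (0 < i)%N -> p ^+ i != 1) (M K i : nat) :
  (K < M)%N ->
  (1 - p ^+ K.+1) * inner_summand p M K.+1 i
  - p * (1 - p ^+ (2 * (M - K))) * inner_summand p M K i
  = wz_cert p M K i.+1 - wz_cert p M K i.
Proof.
move=> lt_KM; have [le_iK|lt_Ki] := leqP (2 * i) K.
  have EK : K = (K - 2 * i + 2 * i)%N by lia.
  have EM : M = (K + (M - K.+1).+1)%N by lia.
  have := wz_step_nneg p_neq0 p_nu (M - K.+1) (K - 2 * i) i.
  by cbv zeta; rewrite -EK -EM.
rewrite /inner_summand /wz_cert.
rewrite (@qbinomN _ p _ (K%:Z - _)) ?(@qbinomN _ p _ (K%:Z + 1 - (2 * i.+1)%:Z)); try lia.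
rewrite !mulr0 subr0 sub0r.
have [eq_iK|ne_iK] := eqVneq (2 * i)%N K.+1; last first.
  rewrite (@qbinomN _ p _ (K.+1%:Z - _)) ?(@qbinomN _ p _ (K%:Z + 1 - _)); try lia.
  by rewrite !mulr0 oppr0.
have -> : (K.+1%:Z - (2 * i)%:Z)%R = 0%:Z by lia.
have -> : (K%:Z + 1 - (2 * i)%:Z)%R = 0%:Z by lia.
have -> : (K.+1 + 1 - 2 * i = 1)%N by lia.
have -> : (K + 3 - 2 * i = 2)%N by lia.
rewrite !qbinom_low0 -eq_iK binn exprD expr0.
have := @qbinom_prev_low F (p ^+ 2) (expf_neq0 _ p_neq0) (sqr_not_unity_root p_nu) M i ltac:(lia).
rewrite -!exprM.
have -> : p ^+ (2 * (M.+1 - i)) = p ^+ (2 * (M - K)) * p ^+ (2 * i).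
  by rewrite -exprD; congr (_ ^+ _); lia.
move: (p ^+ (2 * (M - K))) (p ^+ (2 * i)) => e y Eab.
rewrite mul1r !mulr1 mulrBr Eab.
by field.
Qed.

Lemma inner_summand_eq0 (F : fieldType) (p : F) (M K i : nat) :
  (K < 2 * i)%N -> inner_summand p M K i = 0.
Proof.
by move=> lt_Ki; rewrite /inner_summand (@qbinomN _ p _ (K%:Z - _)) ?mulr0 //; lia.
Qed.

(** Summing the recurrence over i <= K + 1 leaves the certificate at its two
    ends, where it vanishes; the right-hand side obeys the same recurrence
    because (1 - p ^ (M - K)) (1 + p ^ (M - K)) = 1 - p ^ (2 (M - K)). *)
Lemma sum_inner (F : fieldType) (p : F) (p_neq0 : p != 0)
    (p_nu : forall i : nat, (0 < i)%N -> p ^+ i != 1) (M K : nat) :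
  (K <= M)%N ->
  \sum_(0 <= i < K.+1) inner_summand p M K i
  = p ^+ K * qbinom p M K * qpoch (- p ^+ M) p^-1 K.
Proof.
elim: K => [|K IH] le_KM.
  rewrite big_nat1 /inner_summand /qpoch big_ord0 !qbinom_low0 qbinomN //.
  by rewrite muln0 !subr0 expr0 mul1r.
have H1 : \sum_(0 <= i < K.+2)
    ((1 - p ^+ K.+1) * inner_summand p M K.+1 i
     - p * (1 - p ^+ (2 * (M - K))) * inner_summand p M K i) = 0.
  under eq_bigr do rewrite wz_step //.
  rewrite telescope_sumr // /wz_cert.
  rewrite (@qbinomN _ p _ (K%:Z + 1 - (2 * K.+2)%:Z))
    ?(@qbinomN _ (p ^+ 2) _ (0%:Z - _)) //; last lia.
  by rewrite !mulr0 mul0r subr0.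
apply: (mulfI (subr1X_neq0 p_nu (ltn0Sn K))).
move: H1; rewrite sumrB -!mulr_sumr => /subr0_eq ->.
rewrite big_nat_recr //= inner_summand_eq0 ?addr0; last lia.
rewrite IH 1?ltnW // qpochS mulNr expr_div_subn // 1?ltnW //.
have : (1 - p ^+ K.+1) * qbinom p M K.+1 = (1 - p ^+ (M - K)) * qbinom p M K.
  by apply: qbinom_next_low => //; apply: ltnW.
rewrite mulnC exprM (exprS p K).
move: (1 - p * p ^+ K) (qbinom p M K.+1) (qpoch _ _ K) => w B P E.
transitivity (p * p ^+ K * (w * B) * (P * (1 + p ^+ (M - K)))); first by rewrite E; ring.
ring.
Qed.

(** * The second formula solves the system *)

Lemma qpochD (F : fieldType) (A p : F) (r k : nat) :
  qpoch A p (r + k) = qpoch A p r * qpoch (A * p ^+ r) p k.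
Proof.
rewrite /qpoch big_split_ord /=; congr (_ * _).
by apply: eq_bigr => i _; rewrite exprD mulrA.
Qed.

Definition h_sum (F : fieldType) (p : F) (M m : nat) : F :=
  \sum_(0 <= i < (m %/ 2).+1)
    qpoch (- p ^+ M) p^-1 (m - 2 * i)
    * (qbinom (p ^+ 2) (M - m + 2 * i) i - qbinom (p ^+ 2) (M - m + 2 * i) (i%:Z - 1)).

(** Both sides run over the pairs (r, i) with r + 2 i <= k, where
    j = r + 2 i. *)
Lemma sum_triangle (V : zmodType) (f : nat -> nat -> V) (k : nat) :
  \sum_(0 <= j < k.+1) \sum_(0 <= i < (j %/ 2).+1) f (j - 2 * i)%N i
  = \sum_(0 <= r < k.+1) \sum_(0 <= i < k.+1 | (2 * i <= k - r)%N) f r i.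
Proof.
transitivity (\sum_(0 <= j < k.+1) \sum_(0 <= i < k.+1 | (2 * i <= j)%N) f (j - 2 * i)%N i).
  apply: eq_big_nat => j /andP[_ le_jk].
  rewrite [RHS](big_cat_nat (n := (j %/ 2).+1)) //=; last by lia.
  rewrite [X in _ = _ + X]big_nat_cond [X in _ = _ + X]big_pred0 ?addr0; last by move=> i; lia.
  rewrite [RHS]big_mkcond; apply: eq_big_nat => i /andP[_ le_ij].
  by rewrite ifT //; lia.
rewrite (exchange_big_dep_nat predT) //= [RHS](exchange_big_dep_nat predT) //=.
apply: eq_big_nat => i _.
have [le_ik|lt_ki] := leqP (2 * i) k; last first.
  by transitivity (0 : V); [|symmetry]; rewrite big_nat_cond big_pred0 // => j; lia.
rewrite (big_cat_nat (n := 2 * i)) //=; last by lia.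
rewrite big_nat_cond big_pred0 ?add0r; last by move=> j; lia.
rewrite -{1}[(2 * i)%N]add0n big_addn.
rewrite [RHS](big_cat_nat (n := k.+1 - 2 * i)) //=; last by lia.
rewrite [X in _ = _ + X]big_nat_cond [X in _ = _ + X]big_pred0 ?addr0; last by move=> j; lia.
rewrite big_nat_cond [RHS]big_nat_cond; apply: eq_big => [j|j _]; first by lia.
by rewrite addnK.
Qed.

(** The factors 1 - p ^ (2 i) of the base-p^2 symbol split as
    (1 - p ^ i) (1 + p ^ i), and the last quotient in og shifts the resulting
    [M, k]_p to [M + 1, k]_p. *)
Lemma ogE (F : fieldType) (q : F) (q_neq0 : q != 0)
    (q_nu : forall i : nat, (0 < i)%N -> q ^+ i != 1) (M k : nat) :
  (k <= M)%N ->
  og q M.+1 k = qbinom (q ^+ 2) M.+1 k * qpoch (- (q ^+ 2) ^+ M) (q ^+ 2)^-1 k.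
Proof.
move=> le_kM; rewrite /og.
rewrite !exprM (exprM q 2 2 : q ^+ 4 = _).
move: (q ^+ 2) (expf_neq0 2 q_neq0) (sqr_not_unity_root q_nu) => p p_neq0 p_nu.
have D k' := qpochpp_neq0 p_nu k'.
elim: k le_kM => [|k IH] le_kM.
  by rewrite /qpoch !big_ord0 qbinom_low0 !divr1 subn0 divff ?mulr1 ?subr1X_neq0.
have E1 : (M.+1 - k.+1 = M - k)%N by lia.
have E2 : (M.+1 - k = (M - k).+1)%N by lia.
have lt_kM : (0 < M - k)%N by lia.
move/(_ (ltnW le_kM)): IH; rewrite E1 E2.
rewrite (qpochSl ((p ^+ 2) ^+ (M - k))) -exprSr.
rewrite !qpochS mulNr (expr_div_subn p_neq0 (ltnW le_kM)).
have H0 := subr1X_neq0 p_nu (ltn0Sn k).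
have /(canRL (mulKf H0)) -> := @qbinom_next_low F p p_neq0 p_nu M.+1 k ltac:(lia).
have Ec : (p ^+ 2) ^+ (M - k) = p ^+ (M - k) ^+ 2 by rewrite -!exprM mulnC.
rewrite E2 -(exprS p k) Ec.
have H1 := subr1X_neq0 p_nu (ltn0Sn (M - k)).
have H2 := subr1X_neq0 p_nu lt_kM.
move: H0 H1 H2 (D k).
move: (p ^+ k.+1) (p ^+ (M - k).+1) (p ^+ (M - k)) (p ^+ M.+1).
move=> a b c d; move: (qpoch (- _) _ k) (qpoch (_ ^+ _) _ k) (qbinom _ _ _) (qpoch p p k).
move=> A3 A2 A4 A1 H0 H1 H2 H3 E.
have {}E : A2 * (1 - d) = A4 * A3 * A1 * (1 - b).
  by rewrite -E; field; rewrite H1 H3.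
transitivity ((1 - c ^+ 2) * (A2 * (1 - d)) / (A1 * (1 - a) * (1 - c))).
  by field; rewrite H0 H2 H3.
by rewrite E; field; rewrite H0 H2 H3.
Qed.

Lemma og_h_sum (F : fieldType) (p : F) (p_neq0 : p != 0)
    (p_nu : forall i : nat, (0 < i)%N -> p ^+ i != 1) (M k : nat) :
  (k <= M)%N ->
  \sum_(0 <= j < k.+1)
    p ^+ 'C(k - j + 1, 2) * h_sum p M j * qbinom p (2 * M + 1 - k - j) (k - j)%N
  = qbinom p M.+1 k * qpoch (- p ^+ M) p^-1 k.
Proof.
move=> le_kM.
transitivity (\sum_(0 <= j < k.+1) \sum_(0 <= i < (j %/ 2).+1)
    qpoch (- p ^+ M) p^-1 (j - 2 * i)
    * inner_summand p (M - (j - 2 * i)) (k - (j - 2 * i)) i).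
  apply: eq_big_nat => j /andP[_ le_jk].
  rewrite /h_sum mulr_sumr mulr_suml; apply: eq_big_nat => i /andP[_ le_ij].
  rewrite /inner_summand.
  have -> : (M - j + 2 * i = M - (j - 2 * i))%N by lia.
  have -> : (k - (j - 2 * i) + 1 - 2 * i = k - j + 1)%N by lia.
  have -> : ((k - (j - 2 * i))%:Z - (2 * i)%:Z)%R = (k - j)%N by lia.
  have -> : (2 * (M - (j - 2 * i)) + 1 - (k - (j - 2 * i)) - 2 * i = 2 * M + 1 - k - j)%N.
    by lia.
  ring.
rewrite (sum_triangle (fun r i => qpoch (- p ^+ M) p^-1 r * inner_summand p (M - r) (k - r) i)).
rewrite -(qbinom_hockey_stick p_neq0 p_nu le_kM) mulr_suml.
apply: eq_big_nat => r /andP[_ le_rk].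
have -> : qpoch (- p ^+ M) p^-1 k
    = qpoch (- p ^+ M) p^-1 r * qpoch (- p ^+ (M - r)) p^-1 (k - r).
  by rewrite -[in LHS](subnKC (le_rk : (r <= k)%N)) qpochD mulNr expr_div_subn //; lia.
rewrite -mulr_sumr mulrCA -sum_inner //; last by lia.
congr (_ * _).
rewrite [LHS](big_cat_nat (n := (k - r).+1)) //=; last by lia.
rewrite [X in _ + X]big_nat_cond [X in _ + X]big_pred0 ?addr0; last by move=> i; lia.
rewrite big_mkcond; apply: eq_bigr => i _.
by case: ifP => // /negbT; rewrite -ltnNge => /inner_summand_eq0 ->.
Qed.

Lemma h_equations_unique (F : fieldType) (q : F) (n : nat) (h h' : nat -> F) :
  h_equations q n h -> h_equations q n h' ->
  forall m : nat, (m < n)%N -> h m = h' m.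
Proof.
move=> Eh Eh' m; elim/ltn_ind: m => m IH lt_mn.
have := etrans (esym (Eh m lt_mn)) (Eh' m lt_mn).
rewrite !big_nat_recr //= subnn qbinom_low0 mul0n expr0 !mul1r !mulr1.
have -> : \sum_(0 <= j < m) q ^+ ((m - j) * (m - j + 1)) * h j
      * qbinom (q ^+ 2) (2 * n - 1 - m - j) (m - j)%N
  = \sum_(0 <= j < m) q ^+ ((m - j) * (m - j + 1)) * h' j
      * qbinom (q ^+ 2) (2 * n - 1 - m - j) (m - j)%N.
  apply: eq_big_nat => j /andP[_ lt_jm].
  by rewrite IH //; apply: ltn_trans lt_mn.
exact: addrI.
Qed.

Lemma double_bin2 (d : nat) : (2 * 'C(d + 1, 2) = d * (d + 1))%N.
Proof. by rewrite addn1; elim: d => [//|d IH]; rewrite binS bin1 mulnDr IH; lia. Qed.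

Lemma h_sum_equations (F : fieldType) (q : F) (q_neq0 : q != 0)
    (q_nu : forall i : nat, (0 < i)%N -> q ^+ i != 1) (M : nat) :
  h_equations q M.+1 (h_sum (q ^+ 2) M).
Proof.
move=> k; rewrite ltnS => le_kM.
rewrite ogE // -og_h_sum //; [|exact: expf_neq0|exact: sqr_not_unity_root].
apply: eq_big_nat => j _.
rewrite -exprM double_bin2; congr (_ * _ * qbinom _ _ _); lia.
Qed.

Unset Implicit Arguments.

Theorem theoremA1 (F : fieldType) (q : F) (q_neq0 : q != 0)
    (q_not_unity_root : forall i : nat, (0 < i)%N -> q ^+ i != 1)
    (n : nat) (n_ge1 : (1 <= n)%N)
    (h : nat -> F) (h_def : h_equations q n h)
    (m : nat) (m_le : (m <= n - 1)%N) :
  h m =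
    \sum_(0 <= k < (m %/ 2).+1)
      qpoch (- q ^+ (2 * n - 2)) (q ^- 2) (m - 2 * k)
      * qbinom (q ^+ 4) (n - m + 2 * k) k%:Z
      * ((1 - q ^+ (4 * (n - m))) / (1 - q ^+ (4 * (n - m + 2 * k))))
      * q ^+ (4 * k)
  /\
  h m =
    \sum_(0 <= k < (m %/ 2).+1)
      qpoch (- q ^+ (2 * n - 2)) (q ^- 2) (m - 2 * k)
      * (qbinom (q ^+ 4) (n - m + 2 * k - 1) k%:Z
         - qbinom (q ^+ 4) (n - m + 2 * k - 1) (k%:Z - 1)).
Proof.
have second_formula : h m =
    \sum_(0 <= k < (m %/ 2).+1)
      qpoch (- q ^+ (2 * n - 2)) (q ^- 2) (m - 2 * k)
      * (qbinom (q ^+ 4) (n - m + 2 * k - 1) k%:Z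
         - qbinom (q ^+ 4) (n - m + 2 * k - 1) (k%:Z - 1)).
  case: n n_ge1 h_def m_le => [//|M] _ h_def; rewrite subn1 /= => le_mM.
  rewrite (h_equations_unique h_def (@h_sum_equations _ _ q_neq0 q_not_unity_root M)) //.
  rewrite /h_sum -!exprM; apply: eq_bigr => k _.
  have -> : (2 * M.+1 - 2 = 2 * M)%N by lia.
  by have -> : (M.+1 - m + 2 * k - 1 = M - m + 2 * k)%N by lia.
split=> //; rewrite second_formula; apply: eq_bigr => k _.
rewrite -2!(mulrA (qpoch _ _ (m - _))); congr (_ * _).
rewrite 3!(exprM q 4) qbinom_diff //.
- exact: expf_neq0.
- by move=> i i_gt0; rewrite -exprM q_not_unity_root // muln_gt0.
- by lia.
Qed.
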